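(* Let $\Psi$ be a context of parameters with positive types and let $N$ be a simple linear pattern over $\Psi$ of type $A$ (i.e. $\Psi\vdash N\Uparrow A$). Then for every closed $M$ with $\Psi\vdash M\Uparrow A$: $\Psi\vdash M\in\|\mathrm{Not}(N)\|:A$ holds if and only if $\Psi\vdash M\in\|N\|:A$ does not hold.
   Context: Strict $\lambda$-calculus. Fix a signature $\Sigma$ of atomic types $a$ and typed constants. Labels $k\in\{1,0,u\}$; types $A::=a\mid A_1\to^k A_2$; terms $M::=c\mid x\mid \lambda x^k{:}A.\,M\mid M_1\,M_2^k$ (applications record the label). Contexts are finite sets of declarations with distinct variables; $(\Gamma_1,\Gamma_2)$, $(\Gamma,x{:}A)$ denote unions with disjoint domains. The typing judgment $\Gamma;\Omega;\Delta\vdash M:A$ (unrestricted, irrelevant, strict hypotheses; disjoint domains) is defined by: if $c{:}A\in\Sigma$ then $\Gamma;\Omega;\cdot\vdash c:A$; $(\Gamma,x{:}A);\Omega;\cdot\vdash x:A$; $\Gamma;\Omega;x{:}A\vdash x:A$ (no rule for variables of $\Omega$); from $(\Gamma,x{:}A);\Omega;\Delta\vdash M:B$ infer $\Gamma;\Omega;\Delta\vdash\lambda x^u{:}A.M:A\to^uB$; from $\Gamma;(\Omega,x{:}A);\Delta\vdash M:B$ infer $\Gamma;\Omega;\Delta\vdash\lambda x^0{:}A.M:A\to^0B$; from $\Gamma;\Omega;(\Delta,x{:}A)\vdash M:B$ infer $\Gamma;\Omega;\Delta\vdash\lambda x^1{:}A.M:A\to^1B$; from $\Gamma;\Omega;\Delta\vdash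 M:A\to^uB$ and $(\Gamma,\Delta);\Omega;\cdot\vdash N:A$ infer $\Gamma;\Omega;\Delta\vdash M\,N^u:B$; from $\Gamma;\Omega;\Delta\vdash M:A\to^0B$ and $(\Gamma,\Omega,\Delta);\cdot;\cdot\vdash N:A$ infer $\Gamma;\Omega;\Delta\vdash M\,N^0:B$; from $(\Gamma,\Delta_N);\Omega;\Delta_M\vdash M:A\to^1B$ and $(\Gamma,\Delta_M);\Omega;\Delta_N\vdash N:A$ infer $\Gamma;\Omega;(\Delta_M,\Delta_N)\vdash M\,N^1:B$. Simple patterns. Positive types $P::=a\mid N\to^1P$, negative types $N::=a\mid P\to^uN$; all constants of $\Sigma$ have positive types and $\Psi$ declares parameters of positive types. Existential variables ($E,F,H,Z,\dots$, each with a strict type) are a separate syntactic class. For $\Psi=x_1{:}A_1,\dots,x_n{:}A_n$ (in a fixed standard order), a label sequence is $\Phi=x_1^{k_1}\dots x_n^{k_n}$, $\Phi(x_i)=k_i$; $\Psi^u$ is the sequence with all labels $u$. $\Gamma;\Omega;\Delta\vdash\Phi\ ok$ means $\Gamma,\Omega,\Delta$ partition the declarations of $\Psi$ with $x\in\mathrm{dom}\,\Gamma$ iff $\Phi(x)=u$, $x\in\mathrm{dom}\,\Omega$ iff $\Phi(x)=0$, $x\in\mathrm{dom}\,\Delta$ iff $\Phi(x)=1$. A generalized variable over $\Psi$ at atomic type $a$ is $E\,\Phi$ with $E$ of type $A_1\to^{k_1}\cdots A_n\to^{k_n}a$. Simple patterns $\Psi\vdash M\Uparrow A$: if $(\Psi,x{:}P)\vdash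 M\Uparrow B$ then $\Psi\vdash\lambda x^u{:}P.M\Uparrow P\to^uB$; if $h$ is a constant of $\Sigma$ or variable of $\Psi$ of type $A_1\to^1\cdots\to^1A_n\to^1a$ and $\Psi\vdash M_i\Uparrow A_i$ for all $i$ then $\Psi\vdash h\,M_1^1\dots M_n^1\Uparrow a$; $\Psi\vdash E\,\Phi\Uparrow a$ for a generalized variable over $\Psi$ (so existential variables are applied to all variables in scope). A pattern is linear if no existential variable occurs twice; closed if it contains none. Convention: for fresh $Z$, $Z\,\Phi$ used at non-atomic type $B_1\to^u\cdots\to^uB_m\to^ua$ stands for $\lambda y_1^u{:}B_1\dots\lambda y_m^u{:}B_m.\,Z\,\Phi\,y_1^u\dots y_m^u$. Ground instances $\Psi\vdash M\in\|N\|:A$ ($M$ closed): if $\Gamma;\Omega;\Delta\vdash\Phi\ ok$ and $\Gamma;\Omega;\Delta\vdash M:a$ then $\Psi\vdash M\in\|E\,\Phi\|:a$; if $(\Psi,x{:}A)\vdash M\in\|N\|:B$ then $\Psi\vdash\lambda x^u{:}A.M\in\|\lambda x^u{:}A.N\|:A\to^uB$; if $h{:}A_1\to^1\cdots\to^1A_n\to^1a$ is in $\Sigma$ or $\Psi$ and $\Psi\vdash M_i\in\|N_i\|:A_i$ for all $i$ then $\Psi\vdash h\,M_1^1\dots M_n^1\in\|h\,N_1^1\dots N_n^1\|:a$. For a set $\mathcal N$, $M\in\|\mathcal N\|$ iff $M\in\|N\|$ for some $N\in\mathcal N$. Complement. $\mathrm{Not}(1)=0$, $\mathrm{Not}(0)=1$,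 $\mathrm{Not}(u)=u$; if $\Phi(x_i)\in\{0,1\}$, $\mathrm{Not}_i(\Phi)$ gives $x_i$ label $\mathrm{Not}(\Phi(x_i))$ and every other variable label $u$ (undefined if $\Phi(x_i)=u$). $\Psi\vdash\mathrm{Not}(M)\Rightarrow N:A$ is defined by ($Z$'s fresh existential variables): if $\mathrm{Not}_i(\Phi)$ is defined then $\Psi\vdash\mathrm{Not}(E\,\Phi)\Rightarrow Z\,\mathrm{Not}_i(\Phi):a$; if $(\Psi,x{:}A)\vdash\mathrm{Not}(M)\Rightarrow N:B$ then $\Psi\vdash\mathrm{Not}(\lambda x^u{:}A.M)\Rightarrow\lambda x^u{:}A.N:A\to^uB$; for $h\in\mathrm{dom}(\Sigma\cup\Psi)$ of type $A_1\to^1\cdots\to^1A_n\to^1a$: if $g\in\mathrm{dom}(\Sigma\cup\Psi)$, $g{:}A'_1\to^1\cdots\to^1A'_m\to^1a$, $g\neq h$, then $\Psi\vdash\mathrm{Not}(h\,M_1^1\dots M_n^1)\Rightarrow g\,(Z_1\Psi^u)^1\dots(Z_m\Psi^u)^1:a$; and if $\Psi\vdash\mathrm{Not}(M_i)\Rightarrow N:A_i$ then $\Psi\vdash\mathrm{Not}(h\,M_1^1\dots M_n^1)\Rightarrow h\,(Z_1\Psi^u)^1\dots(Z_{i-1}\Psi^u)^1\,N^1\,(Z_{i+1}\Psi^u)^1\dots(Z_n\Psi^u)^1:a$. $\mathrm{Not}(N)$ is the set of all $Q$ with $\Psi\vdash\mathrm{Not}(N)\Rightarrow Q:A$, and $\Psi\vdash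 M\in\|\mathrm{Not}(N)\|:A$ means $M\in\|Q\|$ for some such $Q$. *)

(* Defs.v *)
From HB Require Import structures.
From mathcomp Require Import all_boot.
Set Implicit Arguments.
Unset Strict Implicit.
Unset Printing Implicit Defensive.

(** Variables are de Bruijn indices: index 0 is the innermost binder, and a
    context lists its most recent declaration first, so that adding a variable
    to a context is [cons]. *)

Inductive label := L1 | L0 | Lu.

Inductive ty (atom : eqType) : Type :=
| Atom of atom
| Arr of label & ty atom & ty atom.   (* Arr k A B is A ->^k B *)

Lemma ty_comparable (atom : eqType) : comparable (ty atom).
Proof.
move=> A B; rewrite /decidable; decide equality; first exact: eq_comparable.
by decide equality.
Defined.

HB.instance Definition _ (atom : eqType) := comparableMixin (@ty_comparable atom).

Record signature := Signature {
  atom : eqType;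
  const : eqType;
  ctype : const -> ty atom }.

(** An existential variable is a name together with its type; there are
    infinitely many of each type, so fresh ones always exist. *)
Definition evar (Sg : signature) : Type := (nat * ty (atom Sg))%type.
Definition etype (Sg : signature) (E : evar Sg) : ty (atom Sg) := E.2.

Inductive tm (Sg : signature) : Type :=
| Const of const Sg
| Var of nat
| EVar of evar Sg
| Lam of label & ty (atom Sg) & tm Sg
| App of label & tm Sg & tm Sg.        (* App k M N is M N^k *)

Arguments Const {Sg} _.
Arguments Var {Sg} _.
Arguments EVar {Sg} _.

Fixpoint evars (Sg : signature) (M : tm Sg) : seq (evar Sg) :=
  match M with
  | Const _ | Var _ => [::]
  | EVar E => [:: E]
  | Lam _ _ M => evars M
  | App _ M N => evars M ++ evars N
  end.

Definition closed_tm (Sg : signature) (M : tm Sg) : Prop := evars M = [::].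
Definition linear_tm (Sg : signature) (M : tm Sg) : Prop := uniq (evars M).

(** ** Typing *)

(** The three zones of a judgment share the numbering of the variables in
    scope: [lookup G x = Some A] means that the zone [G] declares x:A, and
    [lookup G x = None] that x is not in its domain. *)
Definition zone (Sg : signature) := seq (option (ty (atom Sg))).

Definition lookup (Sg : signature) (G : zone Sg) (x : nat) : option (ty (atom Sg)) :=
  nth None G x.

Definition empty_zone (Sg : signature) (G : zone Sg) : Prop :=
  forall x, lookup G x = None.

Definition singleton_zone (Sg : signature) (x : nat) (A : ty (atom Sg)) (G : zone Sg) : Prop :=
  forall y, lookup G y = if y == x then Some A else None.

(** G is the union (G1,G2), the domains of G1 and G2 being disjoint. *)
Definition disjoint_union (Sg : signature) (G1 G2 G : zone Sg) : Prop :=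
  forall x, match lookup G1 x, lookup G2 x with
            | Some _, Some _ => False
            | Some A, None => lookup G x = Some A
            | None, B => lookup G x = B
            end.

(** [typing G O D M A] is G;O;D |- M : A *)
Inductive typing (Sg : signature) :
  zone Sg -> zone Sg -> zone Sg -> tm Sg -> ty (atom Sg) -> Prop :=
| ty_const G O D c :
    empty_zone D -> typing G O D (Const c) (ctype c)
| ty_var_u G O D x A :
    lookup G x = Some A -> empty_zone D -> typing G O D (Var x) A
| ty_var_1 G O D x A :
    singleton_zone x A D -> typing G O D (Var x) A
| ty_lam_u G O D A M B :
    typing (Some A :: G) (None :: O) (None :: D) M B ->
    typing G O D (Lam Lu A M) (Arr Lu A B)
| ty_lam_0 G O D A M B :
    typing (None :: G) (Some A :: O) (None :: D) M B ->
    typing G O D (Lam L0 A M) (Arr L0 A B)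
| ty_lam_1 G O D A M B :
    typing (None :: G) (None :: O) (Some A :: D) M B ->
    typing G O D (Lam L1 A M) (Arr L1 A B)
| ty_app_u G O D GD M N A B :
    disjoint_union G D GD ->
    typing G O D M (Arr Lu A B) ->
    typing GD O [::] N A ->
    typing G O D (App Lu M N) B
| ty_app_0 G O D GO GOD M N A B :
    disjoint_union G O GO -> disjoint_union GO D GOD ->
    typing G O D M (Arr L0 A B) ->
    typing GOD [::] [::] N A ->
    typing G O D (App L0 M N) B
| ty_app_1 G O D DM DN GM GN M N A B :
    disjoint_union DM DN D ->
    disjoint_union G DN GM -> disjoint_union G DM GN ->
    typing GM O DM M (Arr L1 A B) ->
    typing GN O DN N A ->
    typing G O D (App L1 M N) B.

(** ** Simple patterns *)

Inductive positive (atom : eqType) : ty atom -> Prop :=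
| pos_atom a : positive (Atom a)
| pos_arr N P : negative N -> positive P -> positive (Arr L1 N P)
with negative (atom : eqType) : ty atom -> Prop :=
| neg_atom a : negative (Atom a)
| neg_arr P N : positive P -> negative N -> negative (Arr Lu P N).

(** Parameter contexts Psi, and label sequences Phi over them. *)
Definition pctx (Sg : signature) := seq (ty (atom Sg)).
Definition labels := seq label.

Definition all_u (Sg : signature) (Psi : pctx Sg) : labels := nseq (size Psi) Lu.

(** G;O;D |- Phi ok, for Phi a label sequence over Psi *)
Definition labels_ok (Sg : signature) (Psi : pctx Sg) (G O D : zone Sg) (Phi : labels) : Prop :=
  size Phi = size Psi /\
  forall x,
    [/\ lookup G x = (if onth Phi x is Some Lu then onth Psi x else None),
        lookup O x = (if onth Phi x is Some L0 then onth Psi x else None)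
      & lookup D x = (if onth Phi x is Some L1 then onth Psi x else None)].

(** A_1 ->^{k_1} ... A_n ->^{k_n} B, where Psi = x_1:A_1, ..., x_n:A_n; x_n
    comes first in the list Psi. *)
Definition abstract_type (Sg : signature) (Psi : pctx Sg) (Phi : labels)
    (B : ty (atom Sg)) : ty (atom Sg) :=
  foldl (fun C p => Arr p.2 p.1 C) B (zip Psi Phi).

(** E x_1^{k_1} ... x_n^{k_n}; the index of x_n is 0, that of x_1 is n - 1. *)
Definition gapp (Sg : signature) (E : evar Sg) (Phi : labels) : tm Sg :=
  foldr (fun x M => App (nth Lu Phi x) M (Var x)) (EVar E) (iota 0 (size Phi)).

(** E Phi is well typed over Psi at type B. *)
Definition gvar (Sg : signature) (Psi : pctx Sg) (E : evar Sg) (Phi : labels)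
    (B : ty (atom Sg)) : Prop :=
  size Phi = size Psi /\ etype E = abstract_type Psi Phi B.

(** Z Phi used at a type B_1 ->^u ... B_m ->^u a: the abstraction
    \y_1^u:B_1 ... \y_m^u:B_m. Z Phi y_1^u ... y_m^u. *)
Fixpoint gapp_at (Sg : signature) (Z : evar Sg) (Phi : labels) (B : ty (atom Sg)) : tm Sg :=
  match B with
  | Arr Lu B1 B2 => Lam Lu B1 (gapp_at Z (Lu :: Phi) B2)
  | _ => gapp Z Phi
  end.

Inductive head_type (Sg : signature) (Psi : pctx Sg) : tm Sg -> ty (atom Sg) -> Prop :=
| head_const c : head_type Psi (Const c) (ctype c)
| head_var x A : onth Psi x = Some A -> head_type Psi (Var x) A.

Definition arrows (Sg : signature) (As : seq (ty (atom Sg))) (a : atom Sg) : ty (atom Sg) :=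
  foldr (Arr L1) (Atom a) As.

Definition apps (Sg : signature) (h : tm Sg) (Ms : seq (tm Sg)) : tm Sg :=
  foldl (App L1) h Ms.

Inductive simple_pattern (Sg : signature) :
  pctx Sg -> tm Sg -> ty (atom Sg) -> Prop :=
| pat_lam Psi P M B :
    positive P -> simple_pattern (P :: Psi) M B -> simple_pattern Psi (Lam Lu P M) (Arr Lu P B)
| pat_rigid Psi h As a Ms :
    head_type Psi h (arrows As a) ->
    size Ms = size As ->
    (forall i, i < size As -> simple_pattern Psi (nth (Var 0) Ms i) (nth (Atom a) As i)) ->
    simple_pattern Psi (apps h Ms) (Atom a)
| pat_flex Psi E Phi a :
    gvar Psi E Phi (Atom a) -> simple_pattern Psi (gapp E Phi) (Atom a).

(** ** Ground instances *)

(** [instance_of Psi M N A] is Psi |- M in ||N|| : A *)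
Inductive instance_of (Sg : signature) :
  pctx Sg -> tm Sg -> tm Sg -> ty (atom Sg) -> Prop :=
| inst_flex Psi G O D Phi M E a :
    labels_ok Psi G O D Phi ->
    typing G O D M (Atom a) ->
    instance_of Psi M (gapp E Phi) (Atom a)
| inst_lam Psi A M N B :
    instance_of (A :: Psi) M N B ->
    instance_of Psi (Lam Lu A M) (Lam Lu A N) (Arr Lu A B)
| inst_rigid Psi h As a Ms Ns :
    head_type Psi h (arrows As a) ->
    size Ms = size As -> size Ns = size As ->
    (forall i, i < size As ->
       instance_of Psi (nth (Var 0) Ms i) (nth (Var 0) Ns i) (nth (Atom a) As i)) ->
    instance_of Psi (apps h Ms) (apps h Ns) (Atom a).

Definition instance_of_set (Sg : signature) (Psi : pctx Sg) (M : tm Sg)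
    (Ns : tm Sg -> Prop) (A : ty (atom Sg)) : Prop :=
  exists2 N, Ns N & instance_of Psi M N A.

(** ** Complement *)

Definition not_label (k : label) : label :=
  match k with L1 => L0 | L0 => L1 | Lu => Lu end.

Definition not_at (i : nat) (Phi : labels) : option labels :=
  match nth Lu Phi i with
  | Lu => None
  | k => Some (set_nth Lu (nseq (size Phi) Lu) i (not_label k))
  end.

Definition fresh (Sg : signature) (Zs : seq (evar Sg)) (M : tm Sg) : Prop :=
  uniq Zs && ~~ has (mem (evars M)) Zs.

(** Zs are suitable for the arguments Z_1 Psi^u, ..., Z_m Psi^u at types As. *)
Definition gargs_ok (Sg : signature) (Psi : pctx Sg) (Zs : seq (evar Sg)) (As : seq (ty (atom Sg))) : Prop :=
  [seq etype Z | Z <- Zs] = [seq abstract_type Psi (all_u Psi) A | A <- As].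

Definition gargs (Sg : signature) (Psi : pctx Sg) (Zs : seq (evar Sg)) (As : seq (ty (atom Sg))) :
    seq (tm Sg) :=
  [seq gapp_at p.1 (all_u Psi) p.2 | p <- zip Zs As].

(** [complement Psi M N A] is Psi |- Not(M) => N : A. In [not_arg] freshness
    extends to the existential variables introduced in the premise. *)
Inductive complement (Sg : signature) :
  pctx Sg -> tm Sg -> tm Sg -> ty (atom Sg) -> Prop :=
| not_flex Psi E Phi i Phi' Z a :
    not_at i Phi = Some Phi' ->
    gvar Psi Z Phi' (Atom a) ->
    fresh [:: Z] (gapp E Phi) ->
    complement Psi (gapp E Phi) (gapp Z Phi') (Atom a)
| not_lam Psi A M N B :
    complement (A :: Psi) M N B ->
    complement Psi (Lam Lu A M) (Lam Lu A N) (Arr Lu A B)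
| not_head Psi h As g As' a Ms Zs :
    head_type Psi h (arrows As a) -> size Ms = size As ->
    head_type Psi g (arrows As' a) -> g <> h ->
    gargs_ok Psi Zs As' ->
    fresh Zs (apps h Ms) ->
    complement Psi (apps h Ms) (apps g (gargs Psi Zs As')) (Atom a)
| not_arg Psi h As1 A As2 a Ms1 M Ms2 N Zs1 Zs2 :
    head_type Psi h (arrows (As1 ++ A :: As2) a) ->
    size Ms1 = size As1 -> size Ms2 = size As2 ->
    complement Psi M N A ->
    gargs_ok Psi Zs1 As1 -> gargs_ok Psi Zs2 As2 ->
    fresh (Zs1 ++ evars N ++ Zs2) (apps h (Ms1 ++ M :: Ms2)) ->
    complement Psi (apps h (Ms1 ++ M :: Ms2))
      (apps h (gargs Psi Zs1 As1 ++ N :: gargs Psi Zs2 As2)) (Atom a).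

(** The set Not(N), for N a pattern over Psi of type A *)
Definition Not (Sg : signature) (Psi : pctx Sg) (N : tm Sg) (A : ty (atom Sg)) : tm Sg -> Prop :=
  fun Q => complement Psi N Q A.

(* Main.v *)
Require Import Defs.
From mathcomp Require Import all_boot.

(** A closed pattern is built from unrestricted abstractions and strict
    applications only, so every occurrence of a variable in it is strict: under
    a label sequence [Phi] it is typable iff the variables labelled 1 occur in it
    and those labelled 0 do not. Hence it fails to be an instance of [E Phi] iff
    one variable violates its label, iff it is an instance of [Z Not_i(Phi)] for
    some [i]. The rest is an induction on patterns, in which the existential
    variables of the complement are chosen outside an arbitrary finite set so
    that the freshness conditions can be met. *)

Set Implicit Arguments.
Unset Strict Implicit.
Unset Printing Implicit Defensive.

Section Complement.

Variable Sg : signature.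

Implicit Types (M N Q h : tm Sg) (A B : ty (atom Sg)) (Psi : pctx Sg).
Implicit Types (G O D : zone Sg) (E Z : evar Sg) (Phi : labels).

(** * Occurrences of variables, spines of applications, and inversion of closed patterns *)

Fixpoint occ (x : nat) M : bool :=
  match M with
  | Const _ | EVar _ => false
  | Var y => x == y
  | Lam _ _ M => occ x.+1 M
  | App _ M N => occ x M || occ x N
  end.

(** Typing applies one argument at a time, while patterns apply a head to all its arguments at once.
    Unlike being a pattern, this shape survives in partial applications, so it supports induction on
    typing derivations. *)
Fixpoint strict_tm M : bool :=
  match M with
  | Const _ | Var _ => true
  | EVar _ => false
  | Lam Lu _ M => strict_tm M
  | App L1 M N => strict_tm M && strict_tm N
  | _ => false
  end.

Lemma evars_apps h Ms : evars (apps h Ms) = evars h ++ flatten (map (@evars Sg) Ms).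
Proof.
elim: Ms h => [|M Ms IH] h /=; first by rewrite cats0.
by rewrite IH /= catA.
Qed.

Lemma evars_gapp E Phi : evars (gapp E Phi) = [:: E].
Proof.
rewrite /gapp; elim: (iota _ _) => //= x s IH.
by rewrite IH.
Qed.

Lemma evars_gapp_at Z Phi A : evars (gapp_at Z Phi A) = [:: Z].
Proof.
elim: A Phi => [a|[] A _ B IH] Phi /=; rewrite ?evars_gapp //.
Qed.

(** [gapp] and [apps] are functions, not constructors; applying a spine projection to both sides of
    an equation separates and inverts these forms. *)
Fixpoint spine_head M : tm Sg := if M is App _ M' _ then spine_head M' else M.

Fixpoint spine_args M : seq (tm Sg) :=
  if M is App _ M' N then rcons (spine_args M') N else [::].

Fixpoint spine_labels M : labels :=
  if M is App k M' _ then k :: spine_labels M' else [::].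

Lemma spine_head_apps h Ms : spine_head (apps h Ms) = spine_head h.
Proof. by elim: Ms h => //= M Ms IH h; rewrite IH. Qed.

Lemma spine_args_apps h Ms : spine_args (apps h Ms) = spine_args h ++ Ms.
Proof.
elim: Ms h => [|M Ms IH] h /=; first by rewrite cats0.
by rewrite IH /= cat_rcons.
Qed.

Lemma spine_head_gapp E Phi : spine_head (gapp E Phi) = EVar E.
Proof. by rewrite /gapp; elim: (iota _ _). Qed.

Lemma spine_labels_gapp E Phi : spine_labels (gapp E Phi) = Phi.
Proof.
(* This writes [Phi] as a map over the same [iota] that [gapp] folds over. Index 0 is the outermost
   argument, so the labels come out in the order of [Phi]. *)
rewrite -[RHS](mkseq_nth Lu) /mkseq /gapp.
by elim: (iota _ _) => //= x s ->.
Qed.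

Lemma gapp_inj_labels E Phi E' Phi' : gapp E Phi = gapp E' Phi' -> Phi = Phi'.
Proof. by move/(congr1 spine_labels); rewrite !spine_labels_gapp. Qed.

Lemma apps_neq_gapp Psi h A Ms E Phi :
  head_type Psi h A -> apps h Ms <> gapp E Phi.
Proof.
move=> hh /(congr1 spine_head); rewrite spine_head_apps spine_head_gapp.
by case: hh.
Qed.

Lemma lam_neq_gapp k A M E Phi : Lam k A M <> gapp E Phi.
Proof. by move/(congr1 spine_head); rewrite spine_head_gapp. Qed.

Lemma lam_neq_apps Psi h B Ms k A M : head_type Psi h B -> Lam k A M <> apps h Ms.
Proof. by move=> hh /(congr1 spine_head); rewrite spine_head_apps; case: hh. Qed.

Lemma apps_inj Psi h A Ms h' A' Ms' :
  head_type Psi h A -> head_type Psi h' A' ->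
  apps h Ms = apps h' Ms' -> h = h' /\ Ms = Ms'.
Proof.
move=> hh hh' e; split.
  move/(congr1 spine_head): e; rewrite !spine_head_apps.
  by case: hh; case: hh'.
move/(congr1 spine_args): e; rewrite !spine_args_apps.
by case: hh; case: hh'.
Qed.

Lemma head_type_uniq Psi h A A' : head_type Psi h A -> head_type Psi h A' -> A = A'.
Proof.
case=> [c|x B e] H; inversion H; subst => //.
by move: e; rewrite H1 => -[].
Qed.

Lemma arrows_inj As As' (a a' : atom Sg) :
  arrows As a = arrows As' a' -> As = As' /\ a = a'.
Proof.
elim: As As' => [|A As IH] [|A' As'] //=; first by case.
by case=> -> /IH [-> ->].
Qed.

Lemma nth_evars_apps h Ms i : closed_tm (apps h Ms) -> closed_tm (nth (Var 0) Ms i).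
Proof.
rewrite /closed_tm evars_apps => /(congr1 size); rewrite size_cat => /eqP.
rewrite addn_eq0 => /andP[_].
elim: Ms i => [|M Ms IH] [|i] //=; rewrite size_cat addn_eq0 => /andP[].
  by move/nilP.
by move=> _; apply: IH.
Qed.

(** An atomic type excludes an abstraction and closedness excludes a flexible term, which leaves the
    rigid form. *)
Lemma closed_rigid Psi M (a : atom Sg) :
  closed_tm M -> simple_pattern Psi M (Atom a) ->
  exists h As Ms, [/\ M = apps h Ms, head_type Psi h (arrows As a), size Ms = size As
    & forall i, i < size As ->
        closed_tm (nth (Var 0) Ms i) /\
        simple_pattern Psi (nth (Var 0) Ms i) (nth (Atom a) As i)].
Proof.
move eA: (Atom a) => A cM pM.
case: pM cM eA => {Psi M A} [//|Psi h As b Ms hh sz pMs cM [->]|Psi E Phi b _].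
  exists h, As, Ms; split=> // i ilt; split; last exact: pMs.
  exact: nth_evars_apps cM.
by rewrite /closed_tm evars_gapp.
Qed.

Lemma lam_pattern Psi M A B :
  closed_tm M -> simple_pattern Psi M (Arr Lu A B) ->
  exists M', [/\ M = Lam Lu A M', closed_tm M' & simple_pattern (A :: Psi) M' B].
Proof. by move=> cM pM; inversion pM; subst; exists M0. Qed.

(** * Typability of closed patterns *)

Lemma strict_apps h Ms : strict_tm (apps h Ms) = strict_tm h && all strict_tm Ms.
Proof. by elim: Ms h => [|M Ms IH] h /=; rewrite ?andbT // IH /= andbA. Qed.

Lemma closed_strict Psi M A : simple_pattern Psi M A -> closed_tm M -> strict_tm M.
Proof.
elim=> {Psi M A} [Psi P M B _ _ IH|Psi h As a Ms hh sz _ IH|Psi E Phi a _] cM.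
- exact: IH.
- rewrite strict_apps; apply/andP; split; first by case: hh.
  apply/(all_nthP (Var 0)) => i; rewrite sz => ilt; apply: IH => //.
  exact: nth_evars_apps cM.
- by move: cM; rewrite /closed_tm evars_gapp.
Qed.

(** The leaves admit no strict hypothesis other than the variable itself, so each one must be
    consumed at an occurrence. Only an application labelled 0 would make an irrelevant hypothesis
    usable, and strict terms have none. Zones are not assumed disjoint, hence the explicit absence
    from [G] and [D]. *)
Lemma typing_strict_occ G O D M A :
  typing G O D M A -> strict_tm M ->
  (forall x, lookup D x <> None -> occ x M) /\
  (forall x, lookup O x <> None -> lookup G x = None -> lookup D x = None -> ~~ occ x M).
Proof.
elim=> {G O D M A} /=.
- by move=> G O D c eD _; split=> // x; rewrite eD.
- move=> G O D x A Gx eD _; split=> [y|y _ Gy _]; first by rewrite eD.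
  by apply/negP=> /eqP yx; move: Gy; rewrite yx Gx.
- move=> G O D x A sD _; split=> [y|y _ _]; rewrite sD; first by case: eqP.
  by case: eqP.
- move=> G O D A M B _ IH /IH[H1 H2]; split=> x H.
    exact: (H1 x.+1).
  exact: (H2 x.+1).
- by [].
- by [].
- by [].
- by [].
- move=> G O D DM DN GM GN M N A B uD uM uN _ IHM _ IHN /andP[/IHM[M1 M2] /IHN[N1 N2]].
  split=> x.
    move: (uD x) (M1 x) (N1 x).
    case: (lookup DM x) => [T|]; case: (lookup DN x) => [T'|] //= -> H1 H2 H3.
    + by rewrite H1.
    + by rewrite H2 // orbT.
  move=> Ox Gx Dx; rewrite negb_or.
  move: (uD x) (uM x) (uN x) (M2 x) (N2 x); rewrite Gx Dx.
  case: (lookup DM x) => [T|]; case: (lookup DN x) => [T'|] //= _ -> -> H1 H2.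
  by rewrite H1 // H2.
Qed.

(** Unlike a label sequence fixed in advance, this condition can be passed to both sides of a strict
    application, where a variable may be strict on one side and unrestricted on the other. *)
Definition admissible Psi G D M :=
  (forall x A, occ x M -> onth Psi x = Some A ->
     (lookup G x = Some A /\ lookup D x = None) \/
     (lookup G x = None /\ lookup D x = Some A)) /\
  (forall x, lookup D x <> None -> occ x M /\ lookup G x = None).

Definition typable Psi M A :=
  forall G O D, admissible Psi G D M -> typing G O D M A.

Definition restrict (p : pred nat) D : zone Sg :=
  mkseq (fun x => if p x then lookup D x else None) (size D).

(** This is a total version of the disjoint union: on a clash the first zone wins, but it is applied
    only to zones that admissibility makes disjoint. *)
Definition merge_zone G D : zone Sg :=
  mkseq (fun x => if lookup G x is Some A then Some A else lookup D x)
    (maxn (size G) (size D)).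

Lemma lookup_restrict p D x :
  lookup (restrict p D) x = if p x then lookup D x else None.
Proof.
rewrite {1}/lookup; case: (ltnP x (size D)) => hx; first by rewrite nth_mkseq.
by rewrite !nth_default ?size_mkseq // /lookup nth_default //; case: ifP.
Qed.

Lemma lookup_merge G D x :
  lookup (merge_zone G D) x = if lookup G x is Some A then Some A else lookup D x.
Proof.
rewrite {1}/lookup; case: (ltnP x (maxn (size G) (size D))) => hx.
  by rewrite nth_mkseq.
rewrite nth_default ?size_mkseq //.
by move: hx; rewrite geq_max /lookup => /andP[h1 h2]; rewrite !nth_default.
Qed.

Lemma typable_head Psi h A : head_type Psi h A -> typable Psi h A.
Proof.
case=> [c|x B Px] G O D [H1 H2].
  apply: ty_const => x; case e: (lookup D x) => [T|] //.
  by have := H2 x; rewrite e => -[].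
have D0 y : y != x -> lookup D y = None.
  move=> /negbTE yx; case e: (lookup D y) => [T|] //.
  by have := H2 y; rewrite e /= yx => -[].
have [|[Gx Dx]|[Gx Dx]] := H1 x B _ Px; first exact: eqxx.
- apply: ty_var_u Gx _ => y; case: (eqVneq y x) => [-> //|]; exact: D0.
- apply: ty_var_1 => y; case: (eqVneq y x) => [-> //|]; exact: D0.
Qed.

(* Strict hypotheses occurring in both [M] and [N] are handed to [M] and become
   unrestricted for [N]. *)
Lemma typable_app Psi M N A B :
  typable Psi M (Arr L1 A B) -> typable Psi N A -> typable Psi (App L1 M N) B.
Proof.
move=> tM tN G O D [H1 H2].
pose DM := restrict (occ^~ M) D; pose DN := restrict (fun x => ~~ occ x M) D.
apply: (@ty_app_1 _ G O D DM DN (merge_zone G DN) (merge_zone G DM) M N A B).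
- move=> x; rewrite !lookup_restrict.
  by case: (occ x M) => /=; case: (lookup D x).
- move=> x; rewrite lookup_merge !lookup_restrict; have := H2 x.
  case: (lookup D x) => [T|]; case: (lookup G x) => [T'|] //=; case: (occ x M) => //=.
  by case.
- move=> x; rewrite lookup_merge !lookup_restrict; have := H2 x.
  case: (lookup D x) => [T|]; case: (lookup G x) => [T'|] //=; case: (occ x M) => //=.
  by case.
- apply: tM; split=> [x C ox Px|x].
    rewrite lookup_merge !lookup_restrict ox /=; have := H1 x C; rewrite /= ox.
    by case=> // -[-> ->]; [left|right].
  rewrite lookup_merge !lookup_restrict; case: (occ x M) => //= Dx.
  by have [_ ->] := H2 x Dx.
- apply: tN; split=> [x C ox Px|x].
    rewrite lookup_merge !lookup_restrict; have := H1 x C; rewrite /= ox orbT.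
    by case=> // -[-> ->]; case: (occ x M) => /=; [left|left|left|right].
  rewrite lookup_merge !lookup_restrict; have := H2 x; rewrite /=.
  by case: (occ x M) => //= + Dx => /(_ Dx) [-> ->].
Qed.

Lemma typable_lam Psi P M B :
  typable (P :: Psi) M B -> typable Psi (Lam Lu P M) (Arr Lu P B).
Proof.
move=> tM G O D [H1 H2]; apply: ty_lam_u; apply: tM; split.
  by move=> [|x] A ox /= Px; [left|apply: H1].
by move=> [|x] //=; apply: H2.
Qed.

(** The term [h] is arbitrary so that the induction can absorb the arguments into it one by one. *)
Lemma typable_apps Psi h As (a : atom Sg) Ms :
  typable Psi h (arrows As a) -> size Ms = size As ->
  (forall i, i < size As -> typable Psi (nth (Var 0) Ms i) (nth (Atom a) As i)) ->
  typable Psi (apps h Ms) (Atom a).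
Proof.
elim: Ms As h => [|M Ms IH] [|A As] h //= th [sz] tMs.
apply: (IH As) => //; last by move=> i; apply: (tMs i.+1).
apply: typable_app th _; exact: (tMs 0).
Qed.

Lemma closed_typable Psi M A : simple_pattern Psi M A -> closed_tm M -> typable Psi M A.
Proof.
elim=> {Psi M A} [Psi P M B _ _ IH|Psi h As a Ms hh sz _ IH|Psi E Phi a _] cM.
- by apply: typable_lam; apply: IH.
- apply: (typable_apps (typable_head hh)) => // i ilt; apply: IH => //.
  exact: nth_evars_apps cM.
- by move: cM; rewrite /closed_tm evars_gapp.
Qed.

(** * Label sequences as conditions on occurrences *)

Definition compat (k : label) (b : bool) : bool :=
  match k with L1 => b | L0 => ~~ b | Lu => true end.

Lemma onth_labels Phi x : x < size Phi -> onth Phi x = Some (nth Lu Phi x).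
Proof. by elim: Phi x => [|k Phi IH] [|x] //= /IH. Qed.

Definition label_zone (p : pred label) Psi Phi : zone Sg :=
  mkseq (fun x => if p (nth Lu Phi x) then onth Psi x else None) (size Psi).

Lemma lookup_label_zone p Psi Phi x :
  lookup (label_zone p Psi Phi) x = if p (nth Lu Phi x) then onth Psi x else None.
Proof.
rewrite /lookup; case: (ltnP x (size Psi)) => hx; first by rewrite nth_mkseq.
by rewrite nth_default ?size_mkseq // onth_default //; case: ifP.
Qed.

(** The instance rule for [E Phi] asks for zones, whereas the occurrence condition speaks of labels
    only; this supplies the zones. *)
Lemma labels_ok_ex Psi Phi :
  size Phi = size Psi -> exists G O D, labels_ok Psi G O D Phi.
Proof.
move=> sz.
exists (label_zone (fun k => if k is Lu then true else false) Psi Phi).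
exists (label_zone (fun k => if k is L0 then true else false) Psi Phi).
exists (label_zone (fun k => if k is L1 then true else false) Psi Phi).
split=> // x; rewrite !lookup_label_zone; case: (ltnP x (size Psi)) => hx.
  by rewrite onth_labels ?sz //; case: (nth _ _ _).
by rewrite !onth_default ?sz //; split; case: ifP.
Qed.

Lemma typing_compat Psi G O D Phi M A :
  labels_ok Psi G O D Phi -> closed_tm M -> simple_pattern Psi M A ->
  typing G O D M A <-> forall x, compat (nth Lu Phi x) (occ x M).
Proof.
move=> [sz ok] cM pM; split.
  move=> /typing_strict_occ /(_ (closed_strict pM cM)) [H1 H0] x.
  (* Beyond [Phi] the default label is [Lu], which demands nothing. *)
  case: (ltnP x (size Phi)) => hx; last by rewrite nth_default.
  have [B PB] : exists B, onth Psi x = Some B.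
    by have := onthTE Psi x; rewrite -sz hx; case: onth => // B; exists B.
  have [] := ok x; move: (H1 x) (H0 x); rewrite (onth_labels hx) PB.
  case: (nth _ _ _) => //= h1 h0 eG eO eD.
  - by apply: h1; rewrite eD.
  - by apply: h0; rewrite ?eO.
(* Conversely, the occurrence condition makes the zones of [Phi] admissible for [M]. *)
move=> H; apply: (closed_typable pM cM); split=> [x B ox PB|x].
  have hx : x < size Phi.
    by rewrite sz ltnNge; apply/negP => /onth_default; rewrite PB.
  have [] := ok x; have := H x; rewrite (onth_labels hx) PB ox.
  by case: (nth _ _ _) => //= _ -> _ ->; [right|left].
have [-> _ ->] := ok x; case: (ltnP x (size Phi)) => hx; last by rewrite onth_default.
by have := H x; rewrite (onth_labels hx); case: (nth _ _ _).
Qed.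

(** * Instances *)

(** Being an instance of a generalized variable thus becomes a check on each variable, with no zones
    left. The head of the spine rules out the other two instance rules. *)
Lemma instance_flexP Psi M E Phi (a : atom Sg) :
  closed_tm M -> simple_pattern Psi M (Atom a) ->
  instance_of Psi M (gapp E Phi) (Atom a) <->
  size Phi = size Psi /\ forall x, compat (nth Lu Phi x) (occ x M).
Proof.
move=> cM pM; split.
  move eN: (gapp E Phi) => N; move eA: (Atom a) => A inst.
  case: inst cM pM eN eA => {Psi M N A}
    [Psi G O D Phi' M E' a' ok tM cM pM e [ea]
    |Psi A M N B _ _ _ /esym /lam_neq_gapp //
    |Psi h As a' Ms Ns hh _ _ _ _ _ /esym /(apps_neq_gapp hh) //].
  subst a'; have eP := gapp_inj_labels e; subst Phi'.
  by split; [case: ok|apply/(typing_compat ok cM pM)].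
case=> /labels_ok_ex[G [O [D ok]]] /(typing_compat ok cM pM).
exact: inst_flex ok.
Qed.

Lemma instance_lamP Psi M N A B :
  instance_of Psi (Lam Lu A M) (Lam Lu A N) (Arr Lu A B) -> instance_of (A :: Psi) M N B.
Proof. by move=> H; inversion H; subst. Qed.

Lemma instance_rigidP Psi h As (a : atom Sg) M Ns :
  head_type Psi h (arrows As a) ->
  instance_of Psi M (apps h Ns) (Atom a) ->
  exists2 Ms, M = apps h Ms &
    forall i, i < size As ->
      instance_of Psi (nth (Var 0) Ms i) (nth (Var 0) Ns i) (nth (Atom a) As i).
Proof.
move eN: (apps h Ns) => N; move eA: (Atom a) => A hh inst.
case: inst hh eN eA => {Psi M N A}
  [Psi G O D Phi' M E' a' ok tM hh /(apps_neq_gapp hh) //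
  |Psi A M N B _ hh /esym /(lam_neq_apps hh) //
  |Psi h' As' a' Ms Ns' hh' _ _ H hh e [ea]].
subst a'; have [eh eNs] := apps_inj hh hh' e; subst h' Ns'.
have [eAs _] := arrows_inj (head_type_uniq hh hh'); subst As'.
by exists Ms.
Qed.

(** The label u is satisfied by every occurrence pattern. Each abstraction adds one [Lu], and
    [all_u (P :: Psi)] unfolds to exactly the longer sequence that [gapp_at] uses. *)
Lemma instance_all_u Psi M A Z :
  simple_pattern Psi M A -> closed_tm M -> instance_of Psi M (gapp_at Z (all_u Psi) A) A.
Proof.
have flex Psi' M' (a : atom Sg) : simple_pattern Psi' M' (Atom a) -> closed_tm M' ->
    instance_of Psi' M' (gapp Z (all_u Psi')) (Atom a).
  move=> pM cM; apply/(instance_flexP _ _ cM pM); split; first by rewrite size_nseq.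
  by move=> x; rewrite nth_nseq; case: ifP.
elim=> {Psi M A} [Psi P M B _ _ IH|Psi h As a Ms hh sz pMs _|Psi E Phi a g] cM.
- by apply: inst_lam; apply: IH.
- by apply: flex cM; apply: pat_rigid hh sz pMs.
- by move: cM; rewrite /closed_tm evars_gapp.
Qed.

Lemma gargs_ok_size Psi Zs As : gargs_ok Psi Zs As -> size Zs = size As.
Proof. by move/(congr1 size); rewrite !size_map. Qed.

Lemma size_gargs Psi Zs As : gargs_ok Psi Zs As -> size (gargs Psi Zs As) = size As.
Proof. by move/gargs_ok_size => e; rewrite size_map size_zip e minnn. Qed.

Lemma nth_gargs Psi Zs As (A0 : ty (atom Sg)) i :
  gargs_ok Psi Zs As -> i < size As ->
  exists Z, nth (Var 0) (gargs Psi Zs As) i = gapp_at Z (all_u Psi) (nth A0 As i).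
Proof.
move=> /gargs_ok_size e ilt; exists (nth (0, A0) Zs i).
rewrite (nth_map ((0, A0), A0)); last by rewrite size_zip e minnn.
by rewrite nth_zip.
Qed.

Lemma evars_gargs Psi Zs As :
  gargs_ok Psi Zs As -> flatten (map (@evars Sg) (gargs Psi Zs As)) = Zs.
Proof.
move/gargs_ok_size; elim: Zs As => [|Z Zs IH] [|A As] //= [/IH e].
by rewrite evars_gapp_at /= -[in RHS]e.
Qed.

(** * Fresh existential variables *)

Lemma has_mem_cat (T : eqType) (X Y s : seq T) :
  has (mem (X ++ Y)) s = has (mem X) s || has (mem Y) s.
Proof. by rewrite -has_predU; apply: eq_has => x /=; rewrite mem_cat. Qed.

Lemma fresh_evar (X : seq (evar Sg)) A : exists n, (n, A) \notin X.
Proof.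
(* One more than the largest name in [X], taken over all types. *)
exists (\max_(E <- X) E.1).+1; apply/negP => H.
have : (\max_(E <- X) E.1).+1 <= \max_(E <- X) E.1.
  exact: (@leq_bigmax_seq _ X xpredT (fun E : evar Sg => E.1) _ H).
by rewrite ltnn.
Qed.

Lemma fresh_gargs Psi As (X : seq (evar Sg)) :
  exists Zs, [/\ gargs_ok Psi Zs As, uniq Zs & ~~ has (mem X) Zs].
Proof.
elim: As X => [|A As IH] X; first by exists [::].
have [n nX] := fresh_evar X (abstract_type Psi (all_u Psi) A).
set Z : evar Sg := (n, _) in nX.
have [Zs [ok uZ fZ]] := IH (Z :: X).
exists (Z :: Zs); split.
- by rewrite /gargs_ok /= ok.
- rewrite /= uZ andbT; apply: contra fZ => ZZ; apply/hasP; exists Z => //=.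
  exact: mem_head.
- rewrite /= negb_or nX /=; apply: contra fZ => /hasP[W WZ WX].
  by apply/hasP; exists W => //=; rewrite in_cons; apply/orP; right.
Qed.

(** * The complement theorem *)

(** By induction on the complement, [N] and [Q] clash at one place: opposite labels on one variable,
    distinct heads, or, recursively, a body or a single argument. *)
Lemma complement_disjoint Psi N Q A M :
  complement Psi N Q A -> closed_tm M -> simple_pattern Psi M A ->
  instance_of Psi M Q A -> ~ instance_of Psi M N A.
Proof.
move=> c; elim: c M => {Psi N Q A}
  [Psi E Phi i Phi' Z a ni _ _|Psi A N Q B _ IH
  |Psi h As g As' a Ns Zs hh _ hg gh _ _
  |Psi h As1 A As2 a Ns1 N Ns2 Q Zs1 Zs2 hh s1 s2 _ IH ok1 ok2 _] M cM pM.
- move=> /(instance_flexP _ _ cM pM)[_ /(_ i) H'] /(instance_flexP _ _ cM pM)[_ /(_ i) H].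
  move: ni H H'; rewrite /not_at.
  by case: (nth Lu Phi i) => // -[<-]; rewrite nth_set_nth /= eqxx; case: (occ i M).
- have [M' [-> cM' pM']] := lam_pattern cM pM.
  by move=> /instance_lamP H /instance_lamP; apply: IH.
- move=> /(instance_rigidP hg)[Ms e _] /(instance_rigidP hh)[Ms' e' _].
  by apply: gh; rewrite e in e'; case: (apps_inj hg hh e').
- have [g [As [Ms [eM hg sMs pMs]]]] := closed_rigid cM pM.
  move=> /(instance_rigidP hh)[Ms1 e1 H1] /(instance_rigidP hh)[Ms2 e2 H2].
  rewrite {1}eM in e1; have [eg eMs] := apps_inj hg hh e1; subst g Ms1.
  rewrite eM in e2; have [_ eMs] := apps_inj hg hh e2; subst Ms2.
  have [eAs _] := arrows_inj (head_type_uniq hg hh); subst As.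
  (* Position [size As1] holds the argument that was complemented; the two instances are compared
     there. *)
  have ilt : size As1 < size (As1 ++ A :: As2).
    by rewrite size_cat /= addnS ltnS leq_addr.
  have [ci pi] := pMs _ ilt; move: (H1 _ ilt) (H2 _ ilt) pi.
  rewrite !nth_cat !(size_gargs ok1) s1 ltnn subnn /= => i1 i2 pi.
  exact: IH ci pi i1 i2.
Qed.

(** The alternative is given at each index, so a bounded search decides it without excluded
    middle. *)
Lemma forall_or_exists (P Q : nat -> Prop) n :
  (forall i, i < n -> P i \/ Q i) ->
  (forall i, i < n -> P i) \/ exists2 i, i < n & Q i.
Proof.
elim: n => [|n IH] H; first by left.
have [|HP|[i ilt Qi]] := IH; first by move=> i ilt; apply: H; apply: ltnW.
  have [Pn|Qn] := H n (ltnSn n); last by right; exists n.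
  by left=> i; rewrite ltnS leq_eqVlt => /orP[/eqP ->|/HP].
by right; exists i => //; apply: ltnW.
Qed.

Lemma head_eq_dec Psi h A g B : head_type Psi h A -> head_type Psi g B -> g = h \/ g <> h.
Proof.
case=> [c|x C _]; case=> [d|y D _]; try by right.
  by case: (eqVneq d c) => [->|/eqP n]; [left|right=> -[]].
by case: (eqVneq y x) => [->|/eqP n]; [left|right=> -[]].
Qed.

(** Rule [not_arg] wants the variables of the complemented argument distinct from each other, from
    the whole pattern and from the new arguments. Hence the induction carries a list [X] to avoid
    and also yields that [Q] is linear. *)
Lemma instance_or_complement Psi N A :
  simple_pattern Psi N A -> forall M (X : seq (evar Sg)),
  closed_tm M -> simple_pattern Psi M A ->
  instance_of Psi M N A \/
  exists Q, [/\ complement Psi N Q A, uniq (evars Q), ~~ has (mem X) (evars Q)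
             & instance_of Psi M Q A].
Proof.
elim=> {Psi N A} [Psi P N B _ _ IH|Psi h As a Ns hh sz _ IH|Psi E Phi a g] M X cM pM.
- have [M' [-> cM' pM']] := lam_pattern cM pM.
  have [H|[Q [cQ uQ fQ iQ]]] := IH M' X cM' pM'; first by left; apply: inst_lam.
  by right; exists (Lam Lu P Q); split=> //; [apply: not_lam|apply: inst_lam].
- have [k [As' [Ms [eM hk sMs pMs]]]] := closed_rigid cM pM; subst M.
  have [e|ne] := head_eq_dec hh hk; last first.
    right; have [Zs [ok uZ fZ]] := fresh_gargs Psi As' (X ++ evars (apps h Ns)).
    exists (apps k (gargs Psi Zs As')).
    have eZ : evars (apps k (gargs Psi Zs As')) = Zs.
      by rewrite evars_apps evars_gargs //; case: (hk).
    move: fZ; rewrite has_mem_cat negb_or => /andP[fX fN].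
    split; rewrite ?eZ //.
      by apply: not_head hh sz hk ne ok _; rewrite /fresh uZ.
    apply: inst_rigid hk sMs _ _; first exact: size_gargs.
    move=> i ilt; have [ci pi] := pMs i ilt.
    by have [Z ->] := nth_gargs (Atom a) ok ilt; apply: instance_all_u.
  subst k; have [eAs _] := arrows_inj (head_type_uniq hk hh); subst As'.
  (* With equal heads, either all arguments match or one lies in a complement; that complement must
     avoid the variables of the whole application, not only those of its own argument. *)
  have [i ilt|H|[i ilt [Q [cQ uQ fQ iQ]]]] := @forall_or_exists
    (fun i => instance_of Psi (nth (Var 0) Ms i) (nth (Var 0) Ns i) (nth (Atom a) As i))
    (fun i => exists Q, [/\ complement Psi (nth (Var 0) Ns i) Q (nth (Atom a) As i),
       uniq (evars Q), ~~ has (mem (X ++ evars (apps h Ns))) (evars Q)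
       & instance_of Psi (nth (Var 0) Ms i) Q (nth (Atom a) As i)]) (size As) _.
  + by have [ci pi] := pMs i ilt; apply: IH.
  + by left; apply: inst_rigid hh sMs sz H.
  right.
  (* The arguments on either side of [i] become fresh generalized variables, each batch avoiding
     everything chosen before it. *)
  have [Zs1 [ok1 u1 f1]] := fresh_gargs Psi (take i As) ((X ++ evars (apps h Ns)) ++ evars Q).
  have [Zs2 [ok2 u2 f2]] :=
    fresh_gargs Psi (drop i.+1 As) (((X ++ evars (apps h Ns)) ++ evars Q) ++ Zs1).
  move: f1 f2 fQ; rewrite !has_mem_cat !negb_or -!andbA.
  move=> /and3P[f1X f1N f1Q] /and4P[f2X f2N f2Q f21] /andP[fQX fQN].
  have eAs : As = take i As ++ nth (Atom a) As i :: drop i.+1 As.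
    by rewrite -drop_nth // cat_take_drop.
  have eNs : Ns = take i Ns ++ nth (Var 0) Ns i :: drop i.+1 Ns.
    by rewrite -drop_nth ?sz // cat_take_drop.
  have si : size (take i As) = i by rewrite size_takel // ltnW.
  have sg1 := size_gargs ok1; have sg2 := size_gargs ok2.
  have eQ : evars (apps h (gargs Psi Zs1 (take i As) ++ Q :: gargs Psi Zs2 (drop i.+1 As)))
      = Zs1 ++ evars Q ++ Zs2.
    rewrite evars_apps map_cat flatten_cat /= !evars_gargs //.
    by case: (hh).
  have uZ : uniq (Zs1 ++ evars Q ++ Zs2).
    rewrite !cat_uniq u1 u2 uQ has_cat negb_or f21 f2Q !andbT /=.
    by rewrite has_sym.
  exists (apps h (gargs Psi Zs1 (take i As) ++ Q :: gargs Psi Zs2 (drop i.+1 As))).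
  split; rewrite ?eQ //.
  + rewrite eNs; apply: (@not_arg _ Psi h (take i As) (nth (Atom a) As i) (drop i.+1 As)) => //.
    * by rewrite -eAs.
    * by rewrite !size_take sz.
    * by rewrite !size_drop sz.
    * by rewrite -eNs /fresh uZ !has_cat !negb_or f1N fQN f2N.
  + by rewrite !has_cat !negb_or f1X fQX f2X.
  + apply: inst_rigid hh sMs _ _.
      by rewrite [in RHS]eAs !size_cat /= sg1 sg2.
    move=> j jlt; have [cj pj] := pMs j jlt.
    rewrite nth_cat sg1 si; case: (ltngtP j i) => [ji|ij|->]; last by rewrite subnn.
    * have [|Z ->] := nth_gargs (Atom a) ok1 (i := j); first by rewrite si.
      by rewrite nth_take //; apply: instance_all_u.
    (* To the right of [i] the index drops by [i.+1]: the left arguments and [Q] itself are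
       skipped. *)
    * rewrite -(subnSK ij) /=.
      have [|Z ->] := nth_gargs (Atom a) ok2 (i := j - i.+1).
        by rewrite size_drop ltn_sub2r // (leq_ltn_trans _ jlt).
      by rewrite nth_drop subnKC //; apply: instance_all_u.
- have [szP _] := g.
  have [i ilt|H|[i ilt]] := @forall_or_exists
    (fun i => compat (nth Lu Phi i) (occ i M))
    (fun i => ~~ compat (nth Lu Phi i) (occ i M)) (size Phi) _.
  + by case: (compat _ _); [left|right].
  + left; apply/(instance_flexP _ _ cM pM); split=> // x.
    by case: (ltnP x (size Phi)) => [/H //|xs]; rewrite nth_default.
  (* A violated label cannot be [Lu], so [not_at] is defined at [i]. *)
  case eP: (not_at i Phi) => [Phi'|]; last first.
    by move: eP; rewrite /not_at; case: (nth _ _ _).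
  move=> viol; right.
  have [n nX] := fresh_evar (E :: X) (abstract_type Psi Phi' (Atom a)).
  set Z : evar Sg := (n, _) in nX.
  (* The flipped label holds at [i] exactly because the original fails there; all other labels of
     [Phi'] are [Lu]. *)
  have [sP cP] : size Phi' = size Psi /\ forall x, compat (nth Lu Phi' x) (occ x M).
    move: eP viol; rewrite /not_at.
    by case: (nth Lu Phi i) => //= -[<-] viol; (split;
      [by rewrite size_set_nth size_nseq (maxn_idPr ilt)
      |move=> x; rewrite nth_set_nth /= nth_nseq if_same; case: eqP => // -> /=;
       move: viol; case: (occ i M)]).
  exists (gapp Z Phi'); rewrite evars_gapp.
  move: nX; rewrite in_cons negb_or => /andP[nE nX].
  split=> //.
  + apply: not_flex eP _ _ => //.
    by rewrite /fresh evars_gapp /= orbF mem_seq1.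
  + by rewrite /= orbF.
  + by apply/(instance_flexP _ _ cM pM).
Qed.

End Complement.

Theorem theorem6p7 (Sg : signature)
    (Sg_positive : forall c : const Sg, positive (ctype c))
    (Psi : pctx Sg) (Psi_positive : forall P, P \in Psi -> positive P)
    (N : tm Sg) (A : ty (atom Sg))
    (N_pattern : simple_pattern Psi N A) (N_linear : linear_tm N)
    (M : tm Sg) (M_closed : closed_tm M) (M_pattern : simple_pattern Psi M A) :
  instance_of_set Psi M (Not Psi N A) A <-> ~ instance_of Psi M N A.
Proof.
split=> [[Q cQ iQ]|niN]; first exact: complement_disjoint cQ M_closed M_pattern iQ.
have [//|[Q [cQ _ _ iQ]]] := instance_or_complement N_pattern [::] M_closed M_pattern.
by exists Q.
Qed.
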